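(* Let $\xi$, $\psi$ and $\omega$ be non-negative measures on $\mathcal A_0$ such that $\Xi(X)<\infty$ and $\Psi^\xi(X)<\infty$. Then (i) $\Psi^\xi$ is an outer measure on $X$, and (ii) $\Omega^{\psi,\xi}$ is also an outer measure on $X$ if it is finite (i.e. $\Omega^{\psi,\xi}(X)<\infty$).
   Context: Setting. Let $X$ be a set, $S:X\to X$ a bijection, $\mathcal A$ a $\sigma$-algebra on $X$, $\mathcal A_0$ the $\sigma$-algebra generated by $\bigcup_{i\ge 0}S^{-i}\mathcal A$, and $\mathcal A_m:=S^{-m}\mathcal A_0=\{S^{-m}A:A\in\mathcal A_0\}$ for integers $m\le 0$ (so $\mathcal A_0\subset\mathcal A_{-1}\subset\cdots$). For $Q\subset X$ let $\mathcal C(Q)$ be the set of all sequences $(A_m)_{m\le0}$ with $A_m\in\mathcal A_m$ for all $m\le 0$ and $Q\subset\bigcup_{m\le0}A_m$. For non-negative measures $\xi,\psi,\omega$ on $\mathcal A_0$, $Q\subset X$ and $\epsilon>0$ define: $\Xi(Q):=\inf_{(A_m)\in\mathcal C(Q)}\sum_{m\le0}\xi(S^mA_m)$; if $\Xi(Q)<\infty$: $\mathcal C^\xi_\epsilon(Q):=\{(A_m)\in\mathcal C(Q):\sum_{m\le0}\xi(S^mA_m)<\Xi(Q)+\epsilon\}$, $\Psi^\xi_\epsilon(Q):=\inf_{(A_m)\in\mathcal C^\xi_\epsilon(Q)}\sum_{m\le0}\psi(S^mA_m)$, $\Psi^\xi(Q):=\lim_{\epsilon\to0}\Psi^\xi_\epsilon(Q)$;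 if also $\Psi^\xi(Q)<\infty$: $\mathcal C^{\psi,\xi}_\epsilon(Q):=\{(A_m)\in\mathcal C^\xi_\epsilon(Q):\sum_{m\le0}\psi(S^mA_m)<\Psi^\xi(Q)+\epsilon\}$, $\Omega^{\psi,\xi}_\epsilon(Q):=\inf_{(A_m)\in\mathcal C^{\psi,\xi}_\epsilon(Q)}\sum_{m\le0}\omega(S^mA_m)$, $\Omega^{\psi,\xi}(Q):=\lim_{\epsilon\to0}\Omega^{\psi,\xi}_\epsilon(Q)$. An outer measure on $X$ is a set function on all subsets of $X$ with values in $[0,\infty]$ vanishing at $\emptyset$ which is monotone and countably subadditive. *)

(* Defs.v *)
From HB Require Import structures.
From mathcomp Require Import all_boot all_order all_algebra.
From mathcomp Require Import all_classical all_reals all_analysis.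

Set Implicit Arguments.
Unset Strict Implicit.
Unset Printing Implicit Defensive.

Import Order.TTheory GRing.Theory Num.Theory.
Import numFieldNormedType.Exports.

Local Open Scope classical_set_scope.
Local Open Scope ring_scope.
Local Open Scope ereal_scope.

(* The sigma-algebra A on X is the one carried by X : measurableType d.  The
   indices m <= 0 are encoded by n = - m : nat, so that S^m, as a map on
   subsets of X, is the preimage under the n-th iterate of S. *)

Section dynamically_defined.
Context (d : measure_display) (X : measurableType d) (R : realType).
Variable S : X -> X.

Definition past_sets : set (set X) :=
  \bigcup_i [set iter i S @^-1` A | A in @measurable d X].

Definition sigA0 : set (set X) := <<s past_sets >>.

(* A_m for m = - n *)
Definition sigA (n : nat) : set (set X) := [set iter n S @` A | A in sigA0].

Definition covers (Q : set X) : set ((set X)^nat) :=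
  [set A | (forall n, sigA n (A n)) /\ Q `<=` \bigcup_n A n].

(* The sum of mu (S^m A_m) over m <= 0; each set S^m A_m lies in sigA0 when
   A_m is in sigA n and S is injective. *)
Definition cost (mu : set X -> \bar R) (A : (set X)^nat) : \bar R :=
  \sum_(n <oo) mu (iter n S @^-1` A n).

Section outer.
Variables xi psi omega : set X -> \bar R.

Definition Xi (Q : set X) : \bar R := ereal_inf [set cost xi A | A in covers Q].

(* The quantities below are meant for Q with Xi Q < +oo, and those involving
   omega for Q with moreover Psi Q < +oo. *)
Definition covers_xi (e : R) (Q : set X) : set ((set X)^nat) :=
  [set A | covers Q A /\ cost xi A < Xi Q + e%:E].

Definition Psi_eps (e : R) (Q : set X) : \bar R :=
  ereal_inf [set cost psi A | A in covers_xi e Q].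

Definition Psi (Q : set X) : \bar R := lim (Psi_eps e Q @[e --> 0^'+]).

Definition covers_psi_xi (e : R) (Q : set X) : set ((set X)^nat) :=
  [set A | covers_xi e Q A /\ cost psi A < Psi Q + e%:E].

Definition Omega_eps (e : R) (Q : set X) : \bar R :=
  ereal_inf [set cost omega A | A in covers_psi_xi e Q].

Definition Omega (Q : set X) : \bar R := lim (Omega_eps e Q @[e --> 0^'+]).

End outer.
End dynamically_defined.

Definition is_outer_measure (X : Type) (R : realType) (f : set X -> \bar R) :=
  exists mu : {outer_measure set X -> \bar R}, mu = f :> (set X -> \bar R).

(* Main.v *)
(* Psi is the value of a lexicographic minimisation (first xi, then psi), and
   Omega adds one more criterion.  All levels follow from one induction step.
   Let F be the algebra of the sets lying in some A_m.

   - Waiting is free on the whole space: if (A_m) covers X, so does the sequence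
     (S A_(m+1)), at the same costs, and its first term is empty.  So X has
     nearly optimal covers G starting at an index as late as we please, and such
     a G can be cut along any given set E of F: the pieces G inter E and
     G minus E are then nearly optimal for E and for its complement.
   - If A is a nearly optimal cover of E for the previous criteria, then A
     together with G minus E is one of X, so that the cost of G inter E does not
     exceed the cost of A by more than a small error which is uniform in E.
     Hence the new value W is additive on F.
   - A nearly optimal cover (A_m) of an arbitrary set Q is approximated by the
     sets A_0 u ... u A_(-n) of F, which yields the continuity of W from below
     along F; monotonicity and countable subadditivity follow. *)

Require Import Defs.
From HB Require Import structures.
From mathcomp Require Import all_boot all_order all_algebra.
From mathcomp Require Import all_classical all_reals all_analysis.
From mathcomp Require Import lra.

Set Implicit Arguments.
Unset Strict Implicit.
Unset Printing Implicit Defensive.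

Import Order.TTheory GRing.Theory Num.Theory.
Import numFieldNormedType.Exports.

Local Open Scope classical_set_scope.
Local Open Scope ring_scope.
Local Open Scope ereal_scope.

Lemma nneseries_le (R : realType) (u : (\bar R)^nat) (y : \bar R) :
  (forall n, 0 <= u n) -> (forall n, \sum_(0 <= k < n) u k <= y) ->
  \sum_(n <oo) u n <= y.
Proof.
move=> u0 uy; apply: lime_le; first by apply: is_cvg_nneseries => n _ _.
exact: nearW.
Qed.

(** * The increasing filtration of sigma-algebras *)

Section covers_and_costs.
Context (d : measure_display) (X : measurableType d) (R : realType).
Variable S : X -> X.
Hypothesis bS : bijective S.
Local Notation Y := (g_sigma_algebraType (past_sets S)).
Implicit Types (A B G : (set X)^nat) (E Q : set X) (n N : nat).
Implicit Type mu : {measure set Y -> \bar R}.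

Let iter_bij n : bijective (iter n S).
Proof.
elim: n => [|n ih] /=; first by exists id.
exact: (bij_comp bS ih).
Qed.

(** Image and preimage under the bijection [iter n S] are mutually inverse. The preimage form
    reduces all closure properties to those of [measurable] on [Y]. *)
Lemma sigAE n E : sigA S n E <-> sigA0 S (iter n S @^-1` E).
Proof.
have [g gS Sg] := iter_bij n; split.
  move=> [B B0 <-]; suff -> : iter n S @^-1` (iter n S @` B) = B by [].
  apply/seteqP; split=> x /=; last by exists x.
  by move=> [y By /(can_inj gS) <-].
move=> E0; exists (iter n S @^-1` E) => //; apply/seteqP; split=> x /=.
  by move=> [y Ey <-].
by move=> Ex; exists (g x); rewrite /preimage/= ?Sg.
Qed.

Lemma sigA_measurable n E : sigA S n E -> measurable (iter n S @^-1` E : set Y).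
Proof. by move/sigAE. Qed.

Lemma measurable_sigA n E : measurable (iter n S @^-1` E : set Y) -> sigA S n E.
Proof. by move=> ?; apply/sigAE. Qed.

Lemma sigAT n : sigA S n setT.
Proof. by apply: measurable_sigA; rewrite preimage_setT; exact: measurableT. Qed.

Lemma sigAC n E : sigA S n E -> sigA S n (~` E).
Proof.
move=> /sigA_measurable mE; apply: measurable_sigA.
by rewrite preimage_setC; exact: measurableC.
Qed.

Lemma sigA_bigcup n (F : (set X)^nat) :
  (forall k, sigA S n (F k)) -> sigA S n (\bigcup_k F k).
Proof.
move=> mF; apply: measurable_sigA; rewrite preimage_bigcup.
by apply: bigcupT_measurable => k; apply: sigA_measurable.
Qed.

Lemma sigA0s n : sigA S n set0.
Proof. by apply: measurable_sigA; rewrite preimage_set0; exact: measurable0. Qed.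

Lemma sigAU n E E' : sigA S n E -> sigA S n E' -> sigA S n (E `|` E').
Proof.
move=> /sigA_measurable mE /sigA_measurable mE'; apply: measurable_sigA.
by rewrite preimage_setU; exact: measurableU.
Qed.

Lemma sigAI n E E' : sigA S n E -> sigA S n E' -> sigA S n (E `&` E').
Proof.
move=> /sigA_measurable mE /sigA_measurable mE'; apply: measurable_sigA.
by rewrite preimage_setI; exact: measurableI.
Qed.

Lemma sigAD n E E' : sigA S n E -> sigA S n E' -> sigA S n (E `\` E').
Proof. by move=> mE mE'; rewrite setDE; apply: sigAI => //; exact: sigAC. Qed.

(** The sets whose preimage under [S] lies in [sigA0 S] form a sigma-algebra, and it contains the
    generators, because one more preimage only raises the index [i] by one. This is what makes
    [sigA S n] increase with [n]. *)
Lemma sigA0_preimage E : sigA0 S E -> sigA0 S (S @^-1` E).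
Proof.
have sY : sigma_algebra setT (sigA0 S) by exact: smallest_sigma_algebra.
have mS : sigA0 S `<=` [set E | sigA0 S (S @^-1` E)].
  apply: smallest_sub.
    have [s0 sC sU] := sY; split=> /=.
    - by rewrite preimage_set0.
    - by move=> B mB; exact: sC.
    - by move=> F mF; rewrite preimage_bigcup; exact: sU.
  move=> _ [i _ [B mB <-]] /=; apply: sub_sigma_algebra.
  by exists i.+1 => //; exists B => //; apply/funext => x /=; rewrite -iterSr.
exact: mS.
Qed.

Lemma sigA_leS n E : sigA S n E -> sigA S n.+1 E.
Proof.
move=> /sigAE/sigA0_preimage mE; apply/sigAE.
by congr (sigA0 S _) : mE; apply/funext => x /=; rewrite -iterS iterSr.
Qed.

Lemma sigA_le n m E : (n <= m)%N -> sigA S n E -> sigA S m E.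
Proof. by move=> /subnK <-; elim: (m - n)%N => //= k ih /ih/sigA_leS. Qed.

(** * Adapted sequences and their costs *)

Definition adapted A := forall n, sigA S n (A n).

Lemma cost_ge0 mu A : 0 <= cost S mu A.
Proof. exact: nneseries_ge0. Qed.

Lemma cost0 mu : cost S mu (fun=> set0) = 0.
Proof. by apply: eseries0 => n _ _; rewrite preimage_set0 measure0. Qed.

Lemma le_cost mu A B : adapted A -> adapted B -> (forall n, A n `<=` B n) ->
  cost S mu A <= cost S mu B.
Proof.
move=> aA aB AB; apply: lee_nneseries => // n _.
apply: le_measure; rewrite ?inE; last by move=> x /AB.
- by apply: sigA_measurable; exact: aA.
- by apply: sigA_measurable; exact: aB.
Qed.

Lemma cost_bigcup mu (A : nat -> (set X)^nat) : (forall k, adapted (A k)) ->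
  cost S mu (fun n => \bigcup_k A k n) <= \sum_(k <oo) cost S mu (A k).
Proof.
move=> aA; rewrite /cost nneseries_interchange//.
apply: lee_nneseries => // n _; rewrite preimage_bigcup.
apply: measure_sigma_subadditive => //.
  by move=> k; apply: sigA_measurable; exact: aA.
by apply: bigcupT_measurable => k; apply: sigA_measurable; exact: aA.
Qed.

Lemma costU mu A B : adapted A -> adapted B ->
  cost S mu (fun n => A n `|` B n) <= cost S mu A + cost S mu B.
Proof.
move=> aA aB; rewrite /cost -nneseriesD//; apply: lee_nneseries => // n _.
by rewrite preimage_setU; apply: measureU2; apply: sigA_measurable; [exact: aA|exact: aB].
Qed.

(** * Sequences that start late: cutting and delaying *)

Definition waits N A := forall n, (n < N)%N -> A n = set0.

Lemma adaptedI N A E : sigA S N E -> adapted A -> waits N A ->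
  adapted (fun n => A n `&` E).
Proof.
move=> mE aA wA n; have [nN|Nn] := ltnP n N.
  by rewrite (wA n nN) set0I; exact: sigA0s.
by apply: sigAI; [exact: aA|exact: sigA_le mE].
Qed.

Lemma adaptedD N A E : sigA S N E -> adapted A -> waits N A ->
  adapted (fun n => A n `\` E).
Proof. by move=> mE aA wA n; rewrite setDE; apply: (adaptedI (sigAC mE)). Qed.

(** A nonempty [A n] has [n >= N], so [E] also lies in [sigA S n] and each term of the cost splits
    additively. *)
Lemma cost_split mu N A E : sigA S N E -> adapted A -> waits N A ->
  cost S mu (fun n => A n `&` E) + cost S mu (fun n => A n `\` E) = cost S mu A.
Proof.
move=> mE aA wA; rewrite /cost -nneseriesD//; apply: eq_eseriesr => n _.
have [nN|Nn] := ltnP n N.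
  by rewrite (wA n nN) set0I set0D preimage_set0 measure0 adde0.
rewrite [X in mu X + _](_ : _ = (iter n S @^-1` A n) `&` (iter n S @^-1` E))//.
rewrite [X in _ + mu X](_ : _ = (iter n S @^-1` A n) `\` (iter n S @^-1` E))//.
rewrite addeC -measureDI//; apply: sigA_measurable; first exact: aA.
exact: sigA_le mE.
Qed.

Definition delay A n := if n is n'.+1 then S @` A n' else set0.

Lemma adapted_delay A : adapted A -> adapted (delay A).
Proof.
move=> aA [|n] /=; first exact: sigA0s.
have [B mB <-] := aA n; exists B => //.
by rewrite -image_comp.
Qed.

Lemma cost_delay mu A : cost S mu (delay A) = cost S mu A.
Proof.
rewrite /cost nneseries_recl//= preimage_set0 measure0 add0e.
rewrite -(nneseries_addn 1%N)//.
apply: eq_eseriesr => n _. rewrite addn1 /=; congr (mu _).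
apply/seteqP; split=> x /=; last by exists (iter n S x).
by move=> [y Ay /(bij_inj bS) <-].
Qed.

(** Iterate [delay]. Since [S] maps [X] onto [X], a delayed cover of the whole space still covers
    it; for a general set this would fail. *)
Lemma waiting_cover A N : adapted A -> \bigcup_n A n = setT ->
  exists G, [/\ adapted G, waits N G, \bigcup_n G n = setT &
    forall mu, cost S mu G = cost S mu A].
Proof.
move=> aA AT; elim: N => [|N [G [aG wG GT cG]]]; first by exists A.
exists (delay G); split.
- exact: adapted_delay.
- by case=> //= n nN; rewrite (wG n nN) image_set0.
- have [g _ Sg] := bS; apply/seteqP; split=> // x _.
  have : [set: X] (g x) by [].
  by rewrite -GT => -[n _ Gn]; exists n.+1 => //=; exists (g x).
- by move=> mu; rewrite cost_delay.
Qed.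

(** * The algebra F, union of the filtration *)

Definition sigAlg E := exists n, sigA S n E.

Lemma sigAlg2 E E' : sigAlg E -> sigAlg E' ->
  exists n, sigA S n E /\ sigA S n E'.
Proof.
move=> [n mE] [m mE']; exists (maxn n m).
split; first by apply: (sigA_le _ mE); exact: leq_maxl.
by apply: (sigA_le _ mE'); exact: leq_maxr.
Qed.

Lemma sigAlgU E E' : sigAlg E -> sigAlg E' -> sigAlg (E `|` E').
Proof. by move=> mE /(sigAlg2 mE)[n [? ?]]; exists n; exact: sigAU. Qed.

Lemma sigAlgI E E' : sigAlg E -> sigAlg E' -> sigAlg (E `&` E').
Proof. by move=> mE /(sigAlg2 mE)[n [? ?]]; exists n; exact: sigAI. Qed.

Lemma sigAlgD E E' : sigAlg E -> sigAlg E' -> sigAlg (E `\` E').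
Proof. by move=> mE /(sigAlg2 mE)[n [? ?]]; exists n; exact: sigAD. Qed.

Lemma sigAlgC E : sigAlg E -> sigAlg (~` E).
Proof. by move=> [n ?]; exists n; exact: sigAC. Qed.

Lemma sigAlg_bigsetU (F : (set X)^nat) n :
  (forall k, sigAlg (F k)) -> sigAlg (\big[setU/set0]_(k < n) F k).
Proof.
move=> mF; elim/big_ind : _ => //; last exact: sigAlgU.
by exists 0%N; exact: sigA0s.
Qed.

End covers_and_costs.

(** * One level of the lexicographic minimisation *)

Section lexicographic_level.
Context (d : measure_display) (X : measurableType d) (R : realType).
Variable S : X -> X.
Hypothesis bS : bijective S.
Local Notation Y := (g_sigma_algebraType (past_sets S)).
Implicit Types (A B G D : (set X)^nat) (E Q : set X) (n N : nat).

Definition near_opt (I : finType) (c : I -> {measure set Y -> \bar R})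
    (V : I -> set X -> \bar R) (e : R) Q : set (set X)^nat :=
  [set A | covers S Q A /\ forall i, cost S (c i) A < V i Q + e%:E].

Definition next_value (I : finType) (c : I -> {measure set Y -> \bar R})
    (V : I -> set X -> \bar R) (mu : {measure set Y -> \bar R}) Q : \bar R :=
  lim (ereal_inf [set cost S mu A | A in near_opt c V e Q] @[e --> 0^'+]).

(* Since the values V i are lexicographic minima, a cover can be cheaper than
   V i for a criterion i other than the first one.  By the last two fields this
   does not happen beyond errors uniform in the sets, as long as all criteria
   are nearly optimal. *)
Record admissible (I : finType) (c : I -> {measure set Y -> \bar R})
    (V : I -> set X -> \bar R) : Prop := Admissible {
  adm_outer : forall i, is_outer_measure (V i) ;
  adm_fin : forall i, V i setT < +oo ;
  adm_add : forall i E E', sigAlg S E -> sigAlg S E' -> E `&` E' = set0 ->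
    V i E + V i E' <= V i (E `|` E') ;
  adm_cont : forall i D (y : \bar R), (forall n, sigAlg S (D n)) ->
    nondecreasing_seq D -> (forall n, V i (D n) <= y) ->
    V i (\bigcup_n D n) <= y ;
  adm_ex : forall (e : R) Q, (0 < e)%R -> exists A, near_opt c V e Q A ;
  adm_split : forall e : R, (0 < e)%R -> exists eta : R, (0 < eta)%R /\
    forall Q Q' A B, covers S Q A -> covers S Q' B ->
      (forall i, cost S (c i) A + cost S (c i) B < V i Q + V i Q' + eta%:E) ->
      forall i, cost S (c i) A < V i Q + e%:E ;
  adm_low : forall e : R, (0 < e)%R -> exists eta : R, (0 < eta)%R /\
    forall Q A, near_opt c V eta Q A ->
      forall i, V i Q <= cost S (c i) A + e%:E }.

Variables (I : finType) (c : I -> {measure set Y -> \bar R}).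
Variables (V : I -> set X -> \bar R) (mu : {measure set Y -> \bar R}).
Hypothesis adm : admissible c V.
Local Notation K := (near_opt c V).
Local Notation W := (next_value c V mu).
Hypothesis Wfin : W setT < +oo.

Let V_ge0 i Q : 0 <= V i Q.
Proof. by have [m <-] := adm_outer adm i; exact: outer_measure_ge0. Qed.

Let V0 i : V i set0 = 0.
Proof. by have [m <-] := adm_outer adm i; exact: outer_measure0. Qed.

Let le_V i Q Q' : Q `<=` Q' -> V i Q <= V i Q'.
Proof. by have [m <-] := adm_outer adm i; exact: le_outer_measure. Qed.

Let V_fin i Q : V i Q \is a fin_num.
Proof.
rewrite ge0_fin_numE//; apply: le_lt_trans (adm_fin adm i).
exact: le_V.
Qed.

Let V_split i E : V i setT <= V i E + V i (~` E).
Proof.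
by have [m <-] := adm_outer adm i; rewrite -(setUv E); exact: outer_measureU2.
Qed.

Lemma near_opt_le e e' Q : (e <= e')%R -> K e Q `<=` K e' Q.
Proof.
move=> ee' A [cA ltA]; split=> // i; apply: lt_le_trans (ltA i) _.
by rewrite leeD2l// lee_fin.
Qed.

(** The infimum is nonincreasing in [e], so the limit at 0+ exists and is a supremum; [lim] carries
    no information before convergence is known. *)
Lemma next_value_sup Q : W Q = ereal_sup
  [set ereal_inf [set cost S mu A | A in K e Q] | e in [set e : R | (0 < e)%R]].
Proof.
apply: cvg_lim => //.
have := @nonincreasing_at_right_cvge R
  (fun e => ereal_inf [set cost S mu A | A in K e Q]) 0%R (BInfty _ false).
rewrite (_ : [set` Interval (BRight 0%R) +oo%O] = [set e : R | (0 < e)%R]).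
  apply=> // e e' _ _ ee'; apply: ereal_inf_le_tmp => _ [A KA <-].
  by exists A => //; exact: near_opt_le KA.
by apply/seteqP; split=> x /=; rewrite in_itv/= andbT.
Qed.

Lemma next_value_ge0 Q : 0 <= W Q.
Proof.
rewrite next_value_sup; apply: le_trans (ereal_sup_ubound _); last first.
  by exists 1%R => //=; exact: ltr01.
by apply: le_ereal_inf_tmp => _ [A _ <-]; exact: cost_ge0.
Qed.

Lemma next_value_lt Q (y : \bar R) (e : R) : (0 < e)%R -> W Q < y ->
  exists A, K e Q A /\ cost S mu A < y.
Proof.
move=> e0; rewrite next_value_sup => Wy.
have /ereal_inf_lt[_ [A KA <-] Ay] :
    ereal_inf [set cost S mu A | A in K e Q] < y.
  by apply: le_lt_trans Wy; apply: ereal_sup_ubound; exists e.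
by exists A.
Qed.

Lemma next_value_le Q (y : \bar R) :
  (forall e : R, (0 < e)%R -> exists A, K e Q A /\ cost S mu A <= y + e%:E) ->
  W Q <= y.
Proof.
move=> H; rewrite next_value_sup; apply: ge_ereal_sup => _ [e /= e0 <-].
apply/lee_addgt0Pr => t t0.
have [|A [KA Ay]] := H (Num.min e t); first by rewrite lt_min e0.
apply: le_trans (le_trans Ay _); last by rewrite leeD2l// lee_fin ge_min lexx orbT.
apply: ereal_inf_lbound; exists A => //; apply: near_opt_le KA.
by rewrite ge_min lexx.
Qed.

Lemma next_value_gt Q (y : \bar R) : y < W Q ->
  exists e : R, (0 < e)%R /\ forall A, K e Q A -> y <= cost S mu A.
Proof.
rewrite next_value_sup => /ereal_sup_gt[_ [e /= e0 <-] ye].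
exists e; split=> // A KA; apply: le_trans (ltW ye) _.
by apply: ereal_inf_lbound; exists A.
Qed.

(** * Late covers of the whole space, cut along sets of F *)

Lemma near_opt_waiting N (e : R) (y : \bar R) : (0 < e)%R -> W setT < y ->
  exists G, [/\ K e setT G, waits N G & cost S mu G < y].
Proof.
move=> e0 /(next_value_lt e0)[A [[[aA AT] ltA] Ay]].
have [|G [aG wG GT cG]] := waiting_cover R bS N aA; first exact/seteqP.
exists G; split=> //; last by rewrite cG.
by split; [split=> //; rewrite GT|move=> i; rewrite cG].
Qed.

Lemma near_opt_restrict (e : R) : (0 < e)%R -> exists eta : R, (0 < eta)%R /\
  forall N E G, sigA S N E -> K eta setT G -> waits N G ->
    K e E (fun n => G n `&` E).
Proof.
move=> /(adm_split adm)[eta [eta0 H]]; exists eta; split=> // N E G mE.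
move=> [[aG GT] ltG] wG.
have cE : covers S E (fun n => G n `&` E).
  split; first exact: (adaptedI bS mE aG wG).
  by move=> x Ex; have [n _ Gn] := GT x Logic.I; exists n.
have cE' : covers S (~` E) (fun n => G n `\` E).
  split; first exact: (adaptedD bS mE aG wG).
  by move=> x Ex; have [n _ Gn] := GT x Logic.I; exists n.
split=> //; apply: H cE cE' _ => i; rewrite (cost_split bS _ mE)//.
by apply: lt_le_trans (ltG i) _; rewrite leeD2r.
Qed.

Lemma next_value_le_setT E : sigAlg S E -> W E <= W setT.
Proof.
move=> [N mE]; apply: next_value_le => e e0.
have [eta [eta0 H]] := near_opt_restrict e0.
have [|G [KG wG Gy]] := @near_opt_waiting N eta (W setT + e%:E) eta0.
  by rewrite lteDl// ge0_fin_numE// next_value_ge0.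
exists (fun n => G n `&` E); split; first exact: H KG wG.
apply: le_trans (ltW Gy); have [[aG _] _] := KG.
by apply: (le_cost bS) => //; exact: (adaptedI bS mE aG wG).
Qed.

Lemma next_value_fin E : sigAlg S E -> W E \is a fin_num.
Proof.
move=> mE; rewrite ge0_fin_numE ?next_value_ge0//.
exact: le_lt_trans (next_value_le_setT mE) Wfin.
Qed.

Let sigAlgT : sigAlg S [set: X].
Proof. by exists 0%N; exact: (sigAT bS). Qed.

(** * Lower bounds and additivity on F *)

Let cancel_cost (w a g g' : \bar R) (r : R) : w \is a fin_num ->
  0 <= g -> 0 <= g' ->
  w - (r / 2)%:E <= a + g' -> g + g' < w + (r / 2)%:E -> g <= a + r%:E.
Proof.
case: w => [w||]// _; case: g => [g||]//; case: g' => [g'||]//;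
  case: a => [a||]//=; rewrite ?leey// -?EFinD -?EFinN ?lee_fin ?lte_fin; lra.
Qed.

(** Exchange argument: replacing the part of [G] inside [E] by [A] gives a nearly optimal cover of
    [X], which cannot be much cheaper than [G]. So the part of [G] inside [E], a competitor for
    [W E], costs at most [cost S mu A + r]. *)
Lemma next_value_low_alg (r : R) : (0 < r)%R -> exists e : R, (0 < e)%R /\
  forall E A, sigAlg S E -> K e E A -> W E <= cost S mu A + r%:E.
Proof.
move=> r0; have /next_value_gt[e [e0 He]] : W setT - (r / 2)%:E < W setT.
  by rewrite lteBlDr// lteDl ?next_value_fin// lte_fin divr_gt0.
exists (e / 2)%R; split; first by rewrite divr_gt0.
move=> E A [N mE] KA; apply: next_value_le => t t0.
(* Precision [t] lets the piece on [E] compete for [W E]; precision [e / 2] on the complement adds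
   up with that of [A] to [e]. *)
have [eta [eta0 H]] := @near_opt_restrict (Num.min t (e / 2))%R ltac:(
  by rewrite lt_min t0 divr_gt0).
have [|G [KG wG Gy]] := @near_opt_waiting N eta (W setT + (r / 2)%:E) eta0.
  by rewrite lteDl ?next_value_fin// lte_fin divr_gt0.
exists (fun n => G n `&` E).
have KE := H _ _ _ mE KG wG.
have := H _ _ _ (sigAC bS mE) KG wG.
have [[aG GT] _] := KG; have [[aA AE] ltA] := KA.
move=> [[aE' GE'] ltE'].
split; first by apply: near_opt_le KE; rewrite ge_min lexx.
have mEt : 0 <= t%:E by rewrite lee_fin ltW.
apply: le_trans (leeDl _ mEt).
apply: (@cancel_cost (W setT) _ _ (cost S mu (fun n => G n `&` ~` E))) => //.
- exact: next_value_fin.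
- exact: cost_ge0.
- exact: cost_ge0.
(* The union of [A] and the rest of [G] is [e]-nearly optimal for [X], because each [V i] is
   additive on F. *)
- apply: le_trans (costU bS mu aA aE'); apply: He; split.
    split; first by move=> n; apply: (sigAU bS); [exact: aA|exact: aE'].
    move=> x _; have [Ex|nEx] := pselect (E x).
      by have [n _ An] := AE x Ex; exists n => //; left.
    by have [n _ An] := GE' x nEx; exists n => //; right.
  move=> i; apply: le_lt_trans (costU bS (c i) aA aE') _.
  apply: lt_le_trans (lteD (ltA i) (ltE' i)) _.
  rewrite addeACA; apply: leeD.
    have mE1 : sigAlg S E by exists N.
    rewrite -(setUv E); apply: (adm_add adm) => //; first exact: sigAlgC.
    exact: classical_sets.setICr.
  by rewrite -EFinD lee_fin {3}(splitr e) lerD2l ge_min lexx orbT.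
- by move: Gy; rewrite -(cost_split bS mu mE aG wG).
Qed.

Let near_optU (e : R) E E' A B : sigAlg S E -> sigAlg S E' ->
  E `&` E' = set0 -> K (e / 2)%R E A -> K (e / 2)%R E' B ->
  K e (E `|` E') (fun n => A n `|` B n).
Proof.
move=> mE mE' EE' [[aA AE] ltA] [[aB BE'] ltB]; split.
  split; first by move=> n; apply: (sigAU bS); [exact: aA|exact: aB].
  move=> x [/AE[n _ An]|/BE'[n _ Bn]]; exists n => //; first by left.
  by right.
move=> i; apply: le_lt_trans (costU bS (c i) aA aB) _.
apply: lt_le_trans (lteD (ltA i) (ltB i)) _.
rewrite addeACA -EFinD -splitr leeD2r//; exact: (adm_add adm).
Qed.

Lemma next_valueU_le E E' : sigAlg S E -> sigAlg S E' -> E `&` E' = set0 ->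
  W (E `|` E') <= W E + W E'.
Proof.
move=> mE mE' EE'; apply: next_value_le => e e0.
have e20 : (0 < e / 2)%R by rewrite divr_gt0.
have lt_e2 E1 : sigAlg S E1 -> W E1 < W E1 + (e / 2)%:E.
  by move=> mE1; rewrite lteDl ?next_value_fin.
have [A [KA ltA]] := next_value_lt e20 (lt_e2 _ mE).
have [B [KB ltB]] := next_value_lt e20 (lt_e2 _ mE').
exists (fun n => A n `|` B n); split; first exact: near_optU.
have [[[aA _] _] [[aB _] _]] := (KA, KB).
apply: le_trans (costU bS mu aA aB) _.
by apply: le_trans (ltW (lteD ltA ltB)) _; rewrite addeACA -EFinD -splitr.
Qed.

(** Here [x], [y], [z] stand for [W] on two disjoint sets and on the complement of their union,
    [g1], [g2], [g3] for the costs of the pieces of a cover of cost [g], [u] for [W] of the union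
    and [w] for [W setT]. *)
Let cancel_three (x y z u w g1 g2 g3 g : \bar R) (r : R) :
  x \is a fin_num -> y \is a fin_num -> z \is a fin_num -> u \is a fin_num ->
  w \is a fin_num -> 0 <= g1 -> 0 <= g2 -> 0 <= g3 ->
  x <= g1 + (r / 4)%:E -> y <= g2 + (r / 4)%:E -> z <= g3 + (r / 4)%:E ->
  g1 + g2 + g3 = g -> g < w + (r / 4)%:E -> w <= u + z -> x + y <= u + r%:E.
Proof.
case: x => [x||]//; case: y => [y||]//; case: z => [z||]//.
case: u => [u||]//; case: w => [w||]// _ _ _ _ _.
case: g1 => [g1||]//; case: g2 => [g2||]//; case: g3 => [g3||]//;
  move=> _ _ _ H1 H2 H3 <-; move: H1 H2 H3; rewrite -?EFinD ?lee_fin ?lte_fin//.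
lra.
Qed.

(** One late cover of [X] is cut into three. Each piece costs at least the value of its set minus
    [r / 4], the total is within [r / 4] of [W setT], and subadditivity allows the value of the
    complement to be cancelled. *)
Lemma next_value_addU E E' : sigAlg S E -> sigAlg S E' -> E `&` E' = set0 ->
  W E + W E' <= W (E `|` E').
Proof.
move=> mE mE' EE'; apply/lee_addgt0Pr => r r0.
have r40 : (0 < r / 4)%R by rewrite divr_gt0.
have mU : sigAlg S (E `|` E') by exact: sigAlgU.
have mC : sigAlg S (~` (E `|` E')) by exact: sigAlgC.
have [e [e0 low]] := next_value_low_alg r40.
have [eta [eta0 H]] := near_opt_restrict e0.
have [N [NE NE']] := sigAlg2 bS mE mE'.
have NC : sigA S N (~` (E `|` E')) by apply: (sigAC bS); exact: sigAU.
have [|G [KG wG Gy]] := @near_opt_waiting N eta (W setT + (r / 4)%:E) eta0.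
  by rewrite lteDl ?next_value_fin.
have [[aG GT] _] := KG.
apply: (cancel_three _ _ _ _ _ _ _ _ (low _ _ mE (H _ _ _ NE KG wG))
  (low _ _ mE' (H _ _ _ NE' KG wG)) (low _ _ mC (H _ _ _ NC KG wG)) _ Gy _);
  rewrite ?next_value_fin ?cost_ge0//.
- rewrite -(cost_split bS mu (sigAU bS NE NE') aG wG); congr (_ + _).
  have aGU := adaptedI bS (sigAU bS NE NE') aG wG.
  rewrite -(cost_split bS mu NE aGU); last by move=> n /wG ->; rewrite set0I.
  congr (cost S mu _ + cost S mu _); apply/funext => n.
    by rewrite -setIA (setIidr (@subsetUl _ E E')).
  rewrite setDE -setIA; congr (_ `&` _); apply/seteqP; split=> x /=; last by case=> -[].
  move=> E'x; split; first by right.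
  by move=> Ex; have : (E `&` E') x by []; rewrite EE'.
- rewrite -(setUv (E `|` E')); apply: next_valueU_le => //.
  exact: classical_sets.setICr.
Qed.

Lemma le_next_value_alg E E' : sigAlg S E -> sigAlg S E' -> E `<=` E' ->
  W E <= W E'.
Proof.
move=> mE mE' EE'; rewrite -(setDUK EE').
apply: le_trans (next_value_addU mE (sigAlgD bS mE' mE) _); last exact: setDIK.
by rewrite leeDl// next_value_ge0.
Qed.

Lemma next_valueU2 E E' : sigAlg S E -> sigAlg S E' -> W (E `|` E') <= W E + W E'.
Proof.
move=> mE mE'; have mD := sigAlgD bS (sigAlgU bS mE mE') mE.
rewrite -(setDUK (@subsetUl _ E E')); apply: le_trans (next_valueU_le mE mD _) _.
  exact: setDIK.
by rewrite leeD2l// le_next_value_alg// => x [[]].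
Qed.

Lemma next_value0 : W set0 = 0.
Proof.
apply/eqP; rewrite eq_le next_value_ge0 andbT; apply: next_value_le => e e0.
exists (fun=> set0); rewrite cost0 add0e lee_fin ltW//; split=> //; split=> [|i].
  by split=> // n; exact: sigA0s.
by rewrite cost0 V0 add0e lte_fin.
Qed.

Lemma next_value_bigsetU (F : (set X)^nat) n : (forall k, sigAlg S (F k)) ->
  W (\big[setU/set0]_(k < n) F k) <= \sum_(0 <= k < n) W (F k).
Proof.
move=> mF; elim: n => [|n ih]; first by rewrite big_ord0 big_geq// next_value0.
rewrite big_ord_recr big_nat_recr//=.
by apply: le_trans (next_valueU2 _ (mF n)) _; [exact: sigAlg_bigsetU|rewrite leeD2r].
Qed.

(** * From F to arbitrary sets: continuity from below *)

(** Superadditivity is applied to successive increments. The function [g] is left general to serve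
    both the [V i] and [W]. *)
Lemma sum_seqD_le (g : set X -> \bar R) D n : (forall E, 0 <= g E) ->
  (forall E E', sigAlg S E -> sigAlg S E' -> E `&` E' = set0 ->
    g E + g E' <= g (E `|` E')) ->
  (forall n, sigAlg S (D n)) -> nondecreasing_seq D ->
  \sum_(0 <= k < n) g (seqD D k) <= g (D n).
Proof.
move=> g0 gU mD ndD.
suff H m : \sum_(0 <= k < m.+1) g (seqD D k) <= g (D m).
  by apply: le_trans (H n); rewrite big_nat_recr//= leeDl.
elim: m => [|m ih]; first by rewrite big_nat1.
rewrite big_nat_recr//=; apply: le_trans (leeD2r _ ih) _.
have Dm : D m `<=` D m.+1 by apply/subsetPset; exact: ndD.
rewrite -{2}(setDUK Dm); apply: gU => //; first exact: sigAlgD.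
exact: setDIK.
Qed.

(* Covering the pieces F k separately does not increase the costs c i, since
   these pieces are already almost optimal for V i. *)
Lemma next_value_pieces Q (y : \bar R) :
  (forall e : R, (0 < e)%R -> exists F : (set X)^nat, [/\ Q `<=` \bigcup_k F k,
    forall i, \sum_(k <oo) V i (F k) <= V i Q + e%:E &
    \sum_(k <oo) W (F k) <= y]) ->
  W Q <= y.
Proof.
case: y => [y||] H; last 2 first.
- exact: leey.
- have [F [_ _ Wy]] := H 1%R ltr01.
  have /le_trans/(_ Wy) : 0 <= \sum_(k <oo) W (F k).
    by apply: nneseries_ge0 => *; exact: next_value_ge0.
  by [].
apply: next_value_le => e e0.
(* One [e / 4] pays for the decomposition into pieces, another for the geometric errors of their
   covers; the remainder makes the bound strict. *)
have e40 : (0 < e / 4)%R by rewrite divr_gt0.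
have [F [QF VF WF]] := H _ e40.
have ek0 k : (0 < e / 4 / (2 ^ k.+1)%:R)%R by rewrite divr_gt0// ltr0n expn_gt0.
have WFfin k : W (F k) < +oo.
  apply: le_lt_trans (le_lt_trans WF (ltry y)).
  apply: le_trans (nneseries_lim_ge k.+1 _); last by move=> *; exact: next_value_ge0.
  rewrite big_nat_recr//= leeDr// sume_ge0// => j _; exact: next_value_ge0.
have /choice[A HA] k : exists A, K (e / 4 / (2 ^ k.+1)%:R)%R (F k) A /\
    cost S mu A < W (F k) + (e / 4 / (2 ^ k.+1)%:R)%:E.
  apply: next_value_lt => //; rewrite lteDl ?lte_fin//.
  by rewrite ge0_fin_numE// next_value_ge0.
have aA k : adapted S (A k) by have [[[]]] := HA k.
exists (fun n => \bigcup_k A k n); split; first split.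
- split; first by move=> n; apply: (sigA_bigcup bS) => k; exact: aA.
  move=> x /QF[k _ Fkx]; have [[[_ FA] _] _] := HA k.
  by have [n _ Akn] := FA x Fkx; exists n => //; exists k.
- move=> i; apply: le_lt_trans (cost_bigcup bS (c i) aA) _.
  apply: (@le_lt_trans _ _ (V i Q + (e / 4)%:E + (e / 4)%:E)).
    apply: le_trans (leeD2r _ (VF i)).
    apply: le_trans (epsilon_trick xpredT _ (ltW e40)) => //.
    apply: lee_nneseries => [k _ _|k _]; first exact: cost_ge0.
    by have [[_ ltA] _] := HA k; exact/ltW/ltA.
  rewrite -addeA lteD2lE//.
  by rewrite -EFinD lte_fin; lra.
- apply: le_trans (cost_bigcup bS mu aA) _.
  apply: (@le_trans _ _ (y%:E + (e / 4)%:E)); last first.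
    by rewrite leeD2l// lee_fin; lra.
  apply: le_trans (leeD2r _ WF).
  apply: le_trans (epsilon_trick xpredT _ (ltW e40)); last first.
    by move=> k; exact: next_value_ge0.
  apply: lee_nneseries => [k _ _|k _]; first exact: cost_ge0.
  by have [_ /ltW] := HA k.
Qed.

(** By monotonicity of [V i], a nearly optimal cover of [Q] is also nearly optimal for its own
    union, so [adm_low] applies to that union. *)
Lemma near_opt_bigcup (e : R) : (0 < e)%R -> exists eta : R, (0 < eta)%R /\
  forall Q A, K eta Q A -> forall i, V i (\bigcup_n A n) <= V i Q + e%:E.
Proof.
move=> e0; have e20 : (0 < e / 2)%R by rewrite divr_gt0.
have [eta [eta0 low]] := adm_low adm e20.
exists (Num.min eta (e / 2))%R; split; first by rewrite lt_min eta0.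
move=> Q A [[aA QA] ltA] i.
have /low/(_ i) : K eta (\bigcup_n A n) A.
  split=> [|j]; first by split.
  apply: lt_le_trans (ltA j) _; apply: leeD; first exact: le_V.
  by rewrite lee_fin ge_min lexx.
move=> /le_trans; apply; rewrite {2}(splitr e) EFinD addeA leeD2r//.
apply: le_trans (ltW (ltA i)) _.
by rewrite leeD2l// lee_fin ge_min lexx orbT.
Qed.

(** The partial unions of a nearly optimal cover [A] of [Q] are intersected with [D n]. The
    increments of these sets are the required pieces: [A] controls their [V i], and [D] controls
    their [W]. *)
Lemma next_value_cont Q D (y : \bar R) : (forall n, sigAlg S (D n)) ->
  nondecreasing_seq D -> (forall n, W (D n) <= y) -> Q `<=` \bigcup_n D n ->
  W Q <= y.
Proof.
move=> mD ndD Wy QD; apply: next_value_pieces => e e0.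
have [eta [eta0 Heta]] := near_opt_bigcup e0.
have [A KA] := adm_ex adm Q eta0; have [[aA QA] _] := KA.
pose P n := (\big[setU/set0]_(k < n) A k) `&` D n.
have mP n : sigAlg S (P n).
  apply: (sigAlgI bS) => //; apply: sigAlg_bigsetU => // k.
  by exists k; exact: aA.
have ndP : nondecreasing_seq P.
  move=> n m nm; apply/subsetPset; apply: setISS; last exact/subsetPset/ndD.
  exact: subset_bigsetU.
exists (seqD P); split.
- rewrite eq_bigcup_seqD => x Qx; have [n _ An] := QA x Qx.
  (* The successor is needed because the partial union of index [n] stops before [A n]. *)
  have [m _ Dm] := QD x Qx; exists (maxn n.+1 m) => //; split.
    by rewrite -bigcup_mkord; exists n => //=; exact: leq_maxl.
  by have /subsetPset/(_ x Dm) := ndD _ _ (leq_maxr n.+1 m).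
- move=> i; apply: le_trans (Heta _ _ KA i); apply: nneseries_le => // n.
  apply: le_trans (sum_seqD_le n _ (@adm_add _ _ _ adm i) mP ndP) _ => //.
  by apply: le_V => x [+ _]; rewrite -bigcup_mkord => -[k _ Ak]; exists k.
- apply: nneseries_le => [n|n]; first exact: next_value_ge0.
  apply: le_trans (sum_seqD_le n next_value_ge0 next_value_addU mP ndP) _.
  by apply: le_trans (le_next_value_alg _ _ _) (Wy n) => // x [].
Qed.

Let nd_bigsetU A : nondecreasing_seq (fun n => \big[setU/set0]_(k < n) A k).
Proof. by move=> n m nm; apply/subsetPset; exact: subset_bigsetU. Qed.

Let bigcup_bigsetU A :
  \bigcup_n \big[setU/set0]_(k < n) A k = \bigcup_n A n.
Proof.
apply/seteqP; split=> x [n _]; rewrite -?bigcup_mkord; first by move=> [k _ Ak]; exists k.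
by move=> An; exists n.+1 => //; rewrite -bigcup_mkord; exists n => //=.
Qed.

(** A late enough partial union [E M] has every [V i] close to that of the full union, so [A] is
    nearly optimal for [E M] and the bound on F applies; earlier partial unions follow by
    monotonicity. *)
Lemma next_value_low_bigsetU (r : R) : (0 < r)%R -> exists e : R, (0 < e)%R /\
  forall Q A, K e Q A ->
    forall n, W (\big[setU/set0]_(k < n) A k) <= cost S mu A + r%:E.
Proof.
move=> r0; have [e [e0 low]] := next_value_low_alg r0.
have e20 : (0 < e / 2)%R by rewrite divr_gt0.
exists (e / 2)%R; split=> // Q A [[aA QA] ltA] n.
pose E n := \big[setU/set0]_(k < n) A k.
have mE m : sigAlg S (E m).
  by apply: sigAlg_bigsetU => // k; exists k; exact: aA.
(* Otherwise [adm_cont] would bound the finite value of the union by itself minus [e / 2]. *)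
have /choice[m Hm] i : exists m, V i (\bigcup_n A n) <= V i (E m) + (e / 2)%:E.
  apply: contrapT => /forallNP H.
  have : V i (\bigcup_n A n) <= V i (\bigcup_n A n) - (e / 2)%:E.
    rewrite -{1}bigcup_bigsetU; apply: (@adm_cont _ _ _ adm i E) => //.
      exact: (nd_bigsetU A).
    move=> m; rewrite leeBrDr//; have /negP := H m.
    by rewrite -ltNge => /ltW.
  by rewrite leeBrDr// leNgt lteDl// lte_fin e20.
(* Finiteness of [I] provides one index for all criteria. *)
pose M := maxn n (\max_i m i).
have EM k : (k <= M)%N -> E k `<=` E M.
  by move=> /nd_bigsetU => /(_ A) /subsetPset.
apply: (@le_trans _ _ (W (E M))).
  exact: le_next_value_alg (mE n) (mE M) (EM n (leq_maxl _ _)).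
apply: low => //; split.
  by split=> // x; rewrite /E -bigcup_mkord => -[k _ Ak]; exists k.
move=> i; apply: lt_le_trans (ltA i) _.
rewrite [in leRHS](splitr e) EFinD addeA leeD2r//.
apply: le_trans (le_trans (le_V i QA) (Hm i)) _; rewrite leeD2r//.
by apply: le_V; apply: EM; rewrite leq_max leq_bigmax orbT.
Qed.

Lemma next_value_low (r : R) : (0 < r)%R -> exists e : R, (0 < e)%R /\
  forall Q A, K e Q A -> W Q <= cost S mu A + r%:E.
Proof.
move=> /next_value_low_bigsetU[e [e0 low]]; exists e; split=> // Q A KA.
have [[aA QA] _] := KA.
apply: next_value_cont (nd_bigsetU A) (low _ _ KA) _.
  by move=> n; apply: sigAlg_bigsetU => // k; exists k; exact: aA.
by rewrite bigcup_bigsetU.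
Qed.

Lemma next_value_approx Q (r : R) : (0 < r)%R -> W Q < +oo ->
  exists D, [/\ forall n, sigAlg S (D n), nondecreasing_seq D,
    Q `<=` \bigcup_n D n & forall n, W (D n) <= W Q + r%:E].
Proof.
move=> r0 WQ; have r20 : (0 < r / 2)%R by rewrite divr_gt0.
have [e [e0 low]] := next_value_low_bigsetU r20.
have [|A [KA ltA]] := @next_value_lt Q (W Q + (r / 2)%:E) e e0.
  by rewrite lteDl// ge0_fin_numE// next_value_ge0.
have [[aA QA] _] := KA.
exists (fun n => \big[setU/set0]_(k < n) A k); split.
- by move=> n; apply: sigAlg_bigsetU => // k; exists k; exact: aA.
- exact: (nd_bigsetU A).
- by rewrite bigcup_bigsetU.
- move=> n; apply: le_trans (low _ _ KA n) _.
  by rewrite [in leRHS](splitr r) EFinD addeA leeD2r// ltW.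
Qed.

(** * The outer measure axioms for the new value *)

Lemma le_next_value Q Q' : Q `<=` Q' -> W Q <= W Q'.
Proof.
move=> QQ'; have [WQ'|] := ltP (W Q') +oo; last first.
  by rewrite leye_eq => /eqP ->; rewrite leey.
apply/lee_addgt0Pr => r r0.
have [D [mD ndD Q'D WD]] := next_value_approx r0 WQ'.
by apply: next_value_cont mD ndD WD _; exact: subset_trans Q'D.
Qed.

Lemma next_value_sigma_subadditive : sigma_subadditive W.
Proof.
move=> F; have [Foo|] := ltP (\sum_(k <oo) W (F k)) +oo; last first.
  by rewrite leye_eq => /eqP ->; rewrite leey.
apply/lee_addgt0Pr => r r0.
have rk0 k : (0 < r / (2 ^ k.+1)%:R)%R by rewrite divr_gt0// ltr0n expn_gt0.
have WF k : W (F k) < +oo.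
  apply: le_lt_trans Foo.
  apply: le_trans (nneseries_lim_ge k.+1 _); last by move=> *; exact: next_value_ge0.
  by rewrite big_nat_recr//= leeDr// sume_ge0// => j _; exact: next_value_ge0.
have /choice[D HD] k := next_value_approx (rk0 k) (WF k).
(* A diagonal choice: each [E n] is a finite union, hence in F, and the sequence increases to the
   union of all [D k n]. *)
pose E n := \bigcup_(k in `I_n) D k n.
have EE n : E n = \big[setU/set0]_(k < n) D k n by exact: (bigcup_mkord n (D ^~ n)).
apply: (@next_value_cont _ E).
- by move=> n; rewrite EE; apply: (sigAlg_bigsetU bS (F := D ^~ n)) => k; have [] := HD k.
- move=> n m nm; apply/subsetPset => x [k /= kn Dx].
  exists k => /=; first exact: leq_trans nm.
  by have [_ /(_ _ _ nm)/subsetPset/(_ x Dx)] := HD k.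
- move=> n; rewrite EE; apply: le_trans (@next_value_bigsetU (D ^~ n) n _) _.
    by move=> k; have [] := HD k.
  apply: (@le_trans _ _ (\sum_(0 <= k < n) (W (F k) + (r / (2 ^ k.+1)%:R)%:E))).
    by apply: lee_sum => k _; have [_ _ _] := HD k; exact.
  apply: le_trans (epsilon_trick xpredT _ (ltW r0)); last first.
    by move=> k; exact: next_value_ge0.
  apply: nneseries_lim_ge => k _ _.
  by rewrite adde_ge0 ?next_value_ge0// lee_fin ltW.
- move=> x [k _ Fkx]; have [_ ndD FD _] := HD k.
  have [n _ Dkn] := FD x Fkx; exists (maxn k.+1 n) => //.
  exists k; first exact: leq_maxl.
  by have /subsetPset/(_ x Dkn) := ndD _ _ (leq_maxr k.+1 n).
Qed.

Lemma next_value_outer : is_outer_measure W.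
Proof.
pose m := isOuterMeasure.Build R X W next_value0 next_value_ge0 le_next_value
  next_value_sigma_subadditive.
by exists (HB.pack_for {outer_measure set X -> \bar R} W m).
Qed.

(** * The induction step: adding one criterion, indexed by [None] *)

Definition next_cost (o : option I) := if o is Some i then c i else mu.

Definition next_bound (o : option I) := if o is Some i then V i else W.

Lemma near_opt_next (e : R) Q A : near_opt next_cost next_bound e Q A <->
  K e Q A /\ cost S mu A < W Q + e%:E.
Proof.
split; first by move=> [cA H]; split; [split=> // i; exact: (H (Some i))|exact: (H None)].
by move=> [[cA H] ltA]; split=> [|[i|]]; [exact: cA|exact: H|exact: ltA].
Qed.

Lemma next_value_finite Q : W Q \is a fin_num.
Proof.
rewrite ge0_fin_numE ?next_value_ge0//; apply: le_lt_trans Wfin.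
exact: le_next_value.
Qed.

Let cancel_split (a b w w' : \bar R) (e eta : R) : (eta <= e / 2)%R ->
  w \is a fin_num -> w' \is a fin_num ->
  a + b < w + w' + eta%:E -> w' <= b + (e / 2)%:E -> 0 <= a -> 0 <= b ->
  a < w + e%:E.
Proof.
case: w => [w||]//; case: w' => [w'||]//; case: a => [a||]//; case: b => [b||]//;
  rewrite /= -?EFinD ?lee_fin ?lte_fin ?ltry//; lra.
Qed.

Lemma admissible_next : admissible next_cost next_bound.
Proof.
split.
- by move=> [i|]; [exact: (adm_outer adm)|exact: next_value_outer].
- by move=> [i|] //=; exact: (adm_fin adm).
- move=> [i|]; [exact: (adm_add adm)|exact: next_value_addU].
- move=> [i|]; first exact: (adm_cont adm).
  by move=> D y mD ndD Wy; exact: next_value_cont mD ndD Wy _.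
- move=> e Q e0.
  have [|A [KA ltA]] := @next_value_lt Q (W Q + e%:E) e e0.
    by rewrite lteDl ?next_value_finite.
  by exists A; exact/near_opt_next.
(* The old criteria make both [A] and [B] nearly optimal. Then [B] costs at least [W Q' - e / 2],
   which leaves less than [W Q + e] for [A]. *)
- move=> e e0; have e20 : (0 < e / 2)%R by rewrite divr_gt0.
  have [t [t0 low]] := next_value_low e20.
  have [eta [eta0 H]] := adm_split adm (e := Num.min t e) ltac:(by rewrite lt_min t0).
  exists (Num.min eta (e / 2))%R; split; first by rewrite lt_min eta0.
  move=> Q Q' A B cA cB ltAB.
  have HA : K (Num.min t e) Q A.
    split=> //; apply: H cA cB _ => i; apply: lt_le_trans (ltAB (Some i)) _.
    by rewrite leeD2l// lee_fin ge_min lexx.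
  have HB : K (Num.min t e) Q' B.
    split=> //; apply: H cB cA _ => i.
    rewrite addeC [V i Q' + _]addeC; apply: lt_le_trans (ltAB (Some i)) _.
    by rewrite leeD2l// lee_fin ge_min lexx.
  move=> [i|] /=.
    have [_ ltA] := HA; apply: lt_le_trans (ltA i) _.
    by rewrite leeD2l// lee_fin ge_min lexx orbT.
  apply: (cancel_split _ _ _ (ltAB None)); rewrite ?next_value_finite ?cost_ge0//.
    by rewrite ge_min lexx orbT.
  by apply: low; apply: near_opt_le HB; rewrite ge_min lexx.
- move=> e e0; have [t [t0 low]] := next_value_low e0.
  have [eta [eta0 H]] := adm_low adm e0.
  exists (Num.min t eta); split; first by rewrite lt_min t0.
  move=> Q A /near_opt_next[KA _] [i|] /=.
    by apply: H; apply: near_opt_le KA; rewrite ge_min lexx orbT.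
  by apply: low; apply: near_opt_le KA; rewrite ge_min lexx.
Qed.

End lexicographic_level.

(** * The three levels: [Xi], [Psi] and [Omega] *)

Section lexicographic_levels.
Context (d : measure_display) (X : measurableType d) (R : realType).
Variable S : X -> X.
Hypothesis bS : bijective S.
Local Notation Y := (g_sigma_algebraType (past_sets S)).
Variables xi psi omega : {measure set Y -> \bar R}.

(** The induction starts without any criterion: every cover is then nearly optimal, and the next
    value for [xi] is a plain infimum. *)
Let c0 : void -> {measure set Y -> \bar R} := of_void _.
Let V0 : void -> set X -> \bar R := of_void _.

Lemma admissible_void : admissible c0 V0.
Proof.
split=> [[]|[]|[]|[]|e Q e0|e e0|e e0]; last 2 first.
- by exists 1%R; split=> // Q Q' A B _ _ _ [].
- by exists 1%R; split=> // Q A _ [].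
exists (fun=> setT); split=> [|[]]; split=> [n|]; first exact: sigAT.
by move=> x _; exists 0%N.
Qed.

Lemma next_value_void : next_value c0 V0 xi = Xi S xi.
Proof.
apply/funext => Q; rewrite /next_value.
suff -> : (fun e : R => ereal_inf [set cost S xi A | A in near_opt c0 V0 e Q]) =
    cst (Xi S xi Q) by exact: lim_cst.
apply/funext => e /=; congr (ereal_inf (_ @` _)).
by apply/seteqP; split=> A; [case|move=> cA; split=> // -[]].
Qed.

Let c1 := next_cost c0 xi.
Let V1 := next_bound c0 V0 xi.

Lemma near_opt_xi (e : R) Q : near_opt c1 V1 e Q = covers_xi S xi e Q.
Proof.
apply/seteqP; split=> A.
  by move=> /near_opt_next[[cA _]]; rewrite next_value_void.
by move=> [cA ltA]; apply/near_opt_next; rewrite next_value_void; split.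
Qed.

Lemma next_value_xi : next_value c1 V1 psi = Psi S xi psi.
Proof.
apply/funext => Q; rewrite /next_value.
suff -> : (fun e : R => ereal_inf [set cost S psi A | A in near_opt c1 V1 e Q]) =
    Psi_eps S xi psi ^~ Q by [].
by apply/funext => e; rewrite near_opt_xi.
Qed.

Let c2 := next_cost c1 psi.
Let V2 := next_bound c1 V1 psi.

Lemma near_opt_psi_xi (e : R) Q :
  near_opt c2 V2 e Q = covers_psi_xi S xi psi e Q.
Proof.
apply/seteqP; split=> A.
  by move=> /(near_opt_next c1 V1 psi); rewrite near_opt_xi next_value_xi.
by move=> HA; apply/(near_opt_next c1 V1 psi); rewrite near_opt_xi next_value_xi.
Qed.

Lemma next_value_psi_xi : next_value c2 V2 omega = Omega S xi psi omega.
Proof.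
apply/funext => Q; rewrite /next_value.
suff -> : (fun e : R => ereal_inf [set cost S omega A | A in near_opt c2 V2 e Q]) =
    Omega_eps S xi psi omega ^~ Q by [].
by apply/funext => e; rewrite near_opt_psi_xi.
Qed.

Hypotheses (Xi_fin : Xi S xi setT < +oo) (Psi_fin : Psi S xi psi setT < +oo).

Let admissible_xi : admissible c1 V1.
Proof.
by apply: admissible_next => //; [exact: admissible_void|rewrite next_value_void].
Qed.

Let admissible_psi_xi : admissible c2 V2.
Proof. by apply: admissible_next => //; rewrite next_value_xi. Qed.

Lemma Psi_outer : is_outer_measure (Psi S xi psi).
Proof.
rewrite -next_value_xi; apply: next_value_outer => //.
by rewrite next_value_xi.
Qed.

Lemma Omega_outer : Omega S xi psi omega setT < +oo ->
  is_outer_measure (Omega S xi psi omega).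
Proof. by rewrite -next_value_psi_xi => Omega_fin; exact: next_value_outer. Qed.

End lexicographic_levels.

Theorem proposition1 (d : measure_display) (X : measurableType d) (R : realType)
    (S : X -> X) (hS : bijective S)
    (xi psi omega :
       {measure set (g_sigma_algebraType (past_sets S)) -> \bar R})
    (hXi : Xi S xi [set: X] < +oo)
    (hPsi : Psi S xi psi [set: X] < +oo) :
  is_outer_measure (Psi S xi psi) /\
  (Omega S xi psi omega [set: X] < +oo ->
   is_outer_measure (Omega S xi psi omega)).
Proof. by split; [exact: Psi_outer|exact: Omega_outer]. Qed.
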